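(* Let $\kappa$ be an infinite cardinal and let $\Gamma^\ast=\{B^\ast: B\in\Gamma\}\subset X_\kappa^\ast$, where $\Gamma=\{0,1\}^\kappa$. There exists no subset of $\Gamma^\ast$ which is equivalent to the usual $\ell_1(\kappa^+)$-basis.
   Context: Let $\kappa$ be an infinite cardinal; $\kappa^+$ is its successor cardinal. The tree is $\mathcal{D}=\{0,1\}^{<\kappa}=\bigcup_{\eta<\kappa}\{0,1\}^\eta$ ($\eta$ ranging over ordinals); its elements are called nodes; $s\in\{0,1\}^\eta$ has level $lev(s)=\eta$; $\mathcal{D}$ is ordered by the initial segment order $\le$ ($s\le s'$ iff $s'$ extends $s$ as a function). Elements of $\Gamma=\{0,1\}^\kappa$ are called branches; a branch $B=(a_\xi)_{\xi<\kappa}$ is identified with the set of nodes $\{(a_\xi)_{\xi<\eta}:\eta<\kappa\}$. A segment is a linearly ordered subset $\mathcal{I}\subseteq\mathcal{D}$ such that $s<t<s'$ with $s,s'\in\mathcal{I}$ implies $t\in\mathcal{I}$. For a non-empty segment $\mathcal{I}$, let $\eta_1$ be the least level of a node of $\mathcal{I}$; if there is an ordinal $\eta$ and a node $s'$ of level $\eta$ with $s\le s'$ for all $s\in\mathcal{I}$, let $\eta_2$ be the least such $\eta$, and call $\mathcal{I}$ an $\eta_1$-$\eta_2$ segment. A finite family $\{\mathcal{I}_j\}_{j=1}^r$ of segments is admissible if the $\mathcal{I}_j$ are pairwise disjoint and there are ordinals $\eta_1<\eta_2$ such that every $\mathcal{I}_j$ is an $\eta_1$-$\eta_2$ segment. Let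 $c_{00}(\mathcal{D})$ be the space of finitely supported functions $x:\mathcal{D}\to\mathbb{R}$, and for a segment $\mathcal{I}$ put $\mathcal{I}^\ast(x)=\sum_{s\in\mathcal{I}}x(s)$. The space $X_\kappa$ is the completion of $c_{00}(\mathcal{D})$ under the norm $\|x\|=\sup\big(\sum_{j=1}^r|\mathcal{I}_j^\ast(x)|^2\big)^{1/2}$, the supremum being over all finite admissible families $\{\mathcal{I}_j\}_{j=1}^r$. For a branch $B$, $B^\ast\in X_\kappa^\ast$ is the continuous extension to $X_\kappa$ of the (bounded) functional $x\mapsto\sum_{s\in B}x(s)$ on $c_{00}(\mathcal{D})$. For a cardinal $\mu$, a subset $D$ of a Banach space with cardinality $\mu$ is equivalent to the usual $\ell_1(\mu)$-basis if there are constants $C_1,C_2>0$ such that $C_1\sum_{i=1}^n|a_i|\le\|\sum_{i=1}^n a_ix_i\|\le C_2\sum_{i=1}^n|a_i|$ for every $n\in\mathbb{N}$, all pairwise distinct $x_1,\dots,x_n\in D$ and all scalars $a_1,\dots,a_n$. *)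

(* Defs.v *)
From HB Require Import structures.
From mathcomp Require Import all_boot all_order all_algebra.
From mathcomp Require Import all_classical all_reals all_analysis.

Set Implicit Arguments.
Unset Strict Implicit.
Unset Printing Implicit Defensive.

Import Order.TTheory GRing.Theory Num.Theory.
Import numFieldNormedType.Exports.

Local Open Scope classical_set_scope.
Local Open Scope ring_scope.
Local Open Scope card_scope.

Definition card_lt T U (A : set T) (B : set U) : Prop :=
  A #<= B /\ ~ (B #<= A).

(* A cardinal is an initial ordinal.  The ordered type K represents the
   ordinal kappa, and an element a : K represents the ordinal [0, a) < kappa. *)
Definition infinite_cardinal d (K : orderType d) : Prop :=
  [/\ well_founded (fun a b : K => (a < b)%O),
      infinite_set [set: K] &
      forall a : K, card_lt [set b : K | (b < a)%O] [set: K]].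

Definition successor_cardinal (K L : Type) : Prop :=
  card_lt [set: K] [set: L] /\
  forall T : Type, card_lt [set: K] [set: T] -> [set: L] #<= [set: T].

Record node d (K : orderType d) := Node {
  lev : K ;
  digit : {x : K | (x < lev)%O} -> bool
}.

HB.instance Definition _ d (K : orderType d) := gen_eqMixin (node K).
HB.instance Definition _ d (K : orderType d) := gen_choiceMixin (node K).

Section Tree.
Context d (K : orderType d).
Implicit Types (s t : node K) (I : set (node K)).

Definition node_le s t : Prop :=
  (lev s <= lev t)%O /\
  forall (x : K) (xs : (x < lev s)%O) (xt : (x < lev t)%O),
    digit (exist _ x xs) = digit (exist _ x xt).

Definition node_lt s t : Prop := node_le s t /\ s <> t.

(* Branches are functions K -> bool; this is the set of nodes of the branch a. *)
Definition branch_nodes (a : K -> bool) : set (node K) :=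
  range (fun eta : K =>
    Node (fun x : {x : K | (x < eta)%O} => a (proj1_sig x))).

Definition segment I : Prop :=
  (forall s t, I s -> I t -> node_le s t \/ node_le t s) /\
  (forall s t s', I s -> I s' -> node_lt s t -> node_lt t s' -> I t).

Definition least (A : set K) (a : K) : Prop := A a /\ lbound A a.

Definition eta_segment (eta1 eta2 : K) I : Prop :=
  [/\ segment I, I !=set0,
      least [set lev s | s in I] eta1 &
      least [set lev t | t in [set t | forall s, I s -> node_le s t]] eta2].

Definition admissible r (I : 'I_r -> set (node K)) : Prop :=
  trivIset [set: 'I_r] I /\
  exists eta1 eta2 : K,
    (eta1 < eta2)%O /\ forall j, eta_segment eta1 eta2 (I j).

End Tree.

Section FinSupp.
Context (R : realType) (T : Type).

Definition fin_supp : {pred T -> R} :=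
  mem [set x : T -> R | finite_set [set s | x s != 0]].

Lemma fin_supp_submod_closed : submod_closed fin_supp.
Proof.
split=> [|a x y]; rewrite !inE /=.
  by apply: (sub_finite_set _ (finite_set0 T)) => s /=; rewrite eqxx.
move=> finx finy.
apply: (@sub_finite_set _ _ ([set s | x s != 0] `|` [set s | y s != 0])).
  move=> s; change (a * x s + y s != 0 -> x s != 0 \/ y s != 0).
  have [->|xs _] := eqVneq (x s) 0; last by left.
  by rewrite mulr0 add0r => ys; right.
by rewrite finite_setU.
Qed.

HB.instance Definition _ :=
  GRing.isSubmodClosed.Build R (T -> R) fin_supp fin_supp_submod_closed.

Record c00 : Type := MkC00 {
  c00_val :> T -> R ;
  c00_valP : c00_val \in fin_supp
}.

HB.instance Definition _ := [isSub for c00_val].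
HB.instance Definition _ := [Choice of c00 by <:].
HB.instance Definition _ := [SubChoice_isSubLmodule of c00 by <:].

End FinSupp.

Section TreeNorm.
Context (R : realType) d (K : orderType d).

(* The sum has finite support, so that [\sum_(s \in I)] is the usual sum. *)
Definition node_sum (I : set (node K)) (x : c00 R (node K)) : R :=
  \sum_(s \in I) x s.

Definition tree_norm (x : c00 R (node K)) : R :=
  sup [set y : R | exists r (I : 'I_r -> set (node K)),
    admissible I /\ y = Num.sqrt (\sum_(j < r) `|node_sum (I j) x| ^+ 2)].

End TreeNorm.

(* iota exhibits the Banach space X as the completion of V under the norm N;
   this determines X up to an isometric isomorphism over V. *)
Definition is_completion (R : realType) (V : lmodType R) (N : V -> R)
    (X : completeNormedModType R) (iota : {linear V -> X}) : Prop :=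
  (forall v, `|iota v| = N v) /\ dense (range iota).

Section Dual.
Context (R : realType) (X : normedModType R).

Definition continuous_linear_form : {pred X -> R^o} :=
  mem [set f : X -> R^o | linear f /\ continuous f].

Lemma continuous_linear_form_submod_closed :
  submod_closed continuous_linear_form.
Proof.
split=> [|a f g]; rewrite !inE /=.
  by split=> [b u v|]; [rewrite scaler0 addr0|move=> x; exact: cvg_cst].
move=> [lf cf] [lg cg]; split=> [b u v|x].
  change (a *: f (b *: u + v) + g (b *: u + v)
    = b *: (a *: f u + g u) + (a *: f v + g v)).
  by rewrite lf lg !scalerDr !scalerA mulrC addrACA.
by apply: (@cvgD _ R^o); [apply: (@cvgZl_tmp _ R^o); exact: cf|exact: cg].
Qed.

HB.instance Definition _ := GRing.isSubmodClosed.Build R (X -> R^o)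
  continuous_linear_form continuous_linear_form_submod_closed.

Record dual : Type := MkDual {
  dual_val :> X -> R^o ;
  dual_valP : dual_val \in continuous_linear_form
}.

HB.instance Definition _ := [isSub for dual_val].
HB.instance Definition _ := [Choice of dual by <:].
HB.instance Definition _ := [SubChoice_isSubLmodule of dual by <:].

Definition dual_norm (f : dual) : R :=
  sup [set `|f x| | x in [set x : X | `|x| <= 1]].

Lemma dual_linear (f : dual) : linear f.
Proof. by have := dual_valP f; rewrite inE => -[]. Qed.

Lemma dual_continuous (f : dual) : continuous f.
Proof. by have := dual_valP f; rewrite inE => -[]. Qed.

Lemma dual_has_sup (f : dual) :
  has_sup [set `|f x| | x in [set x : X | `|x| <= 1]].
Proof.
split; first by exists `|f 0|; exists 0 => //=; rewrite normr0.
pose g : {linear X -> R^o} :=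
  HB.pack (f : X -> R^o) (GRing.isLinear.Build R X R^o *:%R f (dual_linear f)).
have /linear_boundedP : bounded_near g (nbhs 0).
  by apply: continuous_linear_bounded; exact: dual_continuous.
move=> /pinfty_ex_gt0[M M0 fM]; exists M => _ [x /= x1 <-].
by rewrite (le_trans (fM x))// ler_piMr// ltW.
Qed.

Lemma dual_norm_ub (f : dual) x : `|x| <= 1 -> `|f x| <= dual_norm f.
Proof. by move=> x1; apply: ub_le_sup; [exact: (dual_has_sup f).2|exists x]. Qed.

Lemma dual_normD (f g : dual) : dual_norm (f + g) <= dual_norm f + dual_norm g.
Proof.
apply: ge_sup; first exact: (dual_has_sup (f + g)).1.
move=> _ [x /= x1 <-].
by rewrite (le_trans (ler_normD _ _))// lerD// dual_norm_ub.
Qed.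

Lemma dual_normZ (a : R) (f : dual) : dual_norm (a *: f) = `|a| * dual_norm f.
Proof.
have le b (g : dual) : dual_norm (b *: g) <= `|b| * dual_norm g.
  apply: ge_sup; first exact: (dual_has_sup (b *: g)).1.
  move=> _ [x /= x1 <-].
  change (`|b * g x| <= `|b| * dual_norm g).
  by rewrite normrM ler_wpM2l// dual_norm_ub.
apply/eqP; rewrite eq_le le/=.
have [->|a0] := eqVneq a 0.
  rewrite normr0 mul0r (le_trans _ (@dual_norm_ub _ 0 _)) ?normr0//.
have := le a^-1 (a *: f); rewrite scalerA mulVf// scale1r normfV.
by rewrite ler_pdivlMl ?normr_gt0.
Qed.

Lemma dual_norm_eq0 (f : dual) : dual_norm f = 0 -> f = 0.
Proof.
move=> f0; apply/val_inj/funext => x /=.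
have f00 : f 0 = 0.
  by have := dual_linear f (-1) 0 0; rewrite scaler0 addr0 scaleN1r addNr.
have [->|x0] := eqVneq x 0; first by rewrite f00.
have nx0 : `|x| != 0 by rewrite normr_eq0.
have : `|f (`|x|^-1 *: x)| <= 0.
  by rewrite -f0 dual_norm_ub// normrZ normfV normr_id mulVf.
have := dual_linear f `|x|^-1 x 0; rewrite f00 !addr0 => ->.
by rewrite normr_le0 scaler_eq0 invr_eq0 (negPf nx0) /= => /eqP.
Qed.

HB.instance Definition _ := Lmodule_isNormed.Build R dual
  dual_normD dual_normZ dual_norm_eq0.

End Dual.

(* The cardinal mu is given by a set M of that cardinality. *)
Definition equivalent_l1_basis (R : realType) (E : normedModType R)
    (M : Type) (D : set E) : Prop :=
  D #= [set: M] /\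
  exists C1 C2 : R, [/\ 0 < C1, 0 < C2 &
    forall n (x : 'I_n -> E) (a : 'I_n -> R),
      injective x -> (forall i, D (x i)) ->
      C1 * \sum_(i < n) `|a i| <= `|\sum_(i < n) a i *: x i| /\
      `|\sum_(i < n) a i *: x i| <= C2 * \sum_(i < n) `|a i|].

Section Branches.
Context (R : realType) d (K : orderType d) (X : completeNormedModType R).
Variable iota : {linear c00 R (node K) -> X}.

(* Since iota has dense range, at most one phi satisfies this: it is the
   continuous extension B^* to X of the summation along B. *)
Definition is_branch_functional (B : K -> bool) (phi : dual X) : Prop :=
  forall x, phi (iota x) = node_sum (branch_nodes B) x.

Definition Gamma_star : set (dual X) :=
  [set phi | exists B : K -> bool, is_branch_functional B phi].

End Branches.

(* Main.v *)
(* Let D be a set of more than kappa branches.  For every n, some level eta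
   carries n distinct nodes each lying on two branches x_i, y_i of D.  Since
   x_i and y_i agree below eta, the sum of the functionals of x_i minus those
   of y_i is the difference of two sums over n disjoint segments starting at
   level eta, and by Cauchy-Schwarz each of these has norm at most sqrt n.  A
   lower l_1-estimate would give C_1 * 2n <= 2 sqrt n for all n. *)
Require Import Defs.
From mathcomp Require Import all_boot all_order all_algebra finmap.
From mathcomp Require Import all_classical all_reals all_analysis ring lra.

Import Order.TTheory GRing.Theory Num.Theory.
Import numFieldNormedType.Exports.
Local Open Scope classical_set_scope.
Local Open Scope ring_scope.
Local Open Scope card_scope.

(** * Cardinal arithmetic of an infinite initial ordinal *)

Lemma card_le_inj T U (A : set T) (B : set U) (f : T -> U) :
  {in A &, injective f} -> f @` A `<=` B -> A #<= B.
Proof.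
by move=> finj fAB; rewrite -(card_le_eql (inj_card_eq finj)) subset_card_le.
Qed.

Lemma infinite_set_inj T (A : set T) : infinite_set A ->
  exists f : nat -> T, injective f /\ forall n, A (f n).
Proof.
move=> /infiniteP/card_leP[g]; exists (fun n => set_val (g (to_setT n))).
split=> [m n /val_inj gmn|n]; last exact: set_valP.
have : to_setT m = to_setT n by apply: (inj (f := g)) => //; rewrite inE.
by move=> /(congr1 val).
Qed.

Section Cardinal.
Context (d : Order.disp_t) (K : orderType d).
Hypothesis cK : infinite_cardinal K.

Lemma wf_least (P : K -> Prop) : (exists x, P x) ->
  exists x, P x /\ forall y, (y < x)%O -> ~ P y.
Proof.
case: cK => wf _ _ [x Px]; apply: contrapT => nP.
elim/(well_founded_ind wf): x Px => x IH Px.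
by apply: nP; exists x; split.
Qed.

(** With a greatest element [m], the infinite set below [m] could absorb [m], so [K] would inject
    into a proper initial segment, against initiality. *)
Lemma no_max (m : K) : exists x, (m < x)%O.
Proof.
case: cK => _ Kinf Kinit; apply: contrapT => nomax.
have lem x : (x <= m)%O by rewrite leNgt; apply/negP => mx; apply: nomax; exists x.
have [_] := Kinit m; apply.
have Sinf : infinite_set [set b : K | (b < m)%O].
  move=> Sfin; apply: Kinf.
  apply: (@sub_finite_set _ _ ([set b : K | (b < m)%O] `|` [set m])).
    by move=> x _; have := lem x; rewrite le_eqVlt => /orP[/eqP ->|]; [right|left].
  by rewrite finite_setU; split.
have [g [ginj gS]] := infinite_set_inj _ _ Sinf.
(* Hilbert's hotel: [g n] moves to [g n.+1], [m] goes to the vacated [g 0], and all other points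
   stay fixed. *)
pose f x := if pselect (exists n, g n = x) is left e then g (projT1 (cid e)).+1
            else if (x < m)%O then x else g 0%N.
apply: (card_le_inj _ _ _ _ f); last first.
  move=> _ [x _ <-]; rewrite /f; case: pselect => [e|_] /=; first exact: gS.
  by case: ifP => // _; exact: gS.
move=> x y _ _; rewrite /f.
case: pselect => [ex|nx]; case: pselect => [ey|ny].
- by case: cid => i ei; case: cid => j ej /= /ginj[ij]; rewrite -ei -ej ij.
- case: cid => i ei /=; case: ifP => _; last by move=> /ginj.
  by move=> gy; case: ny; exists i.+1.
- case: cid => i ei /=; case: ifP => _; last by move=> /ginj.
  by move=> gy; case: nx; exists i.+1.
case: ifP => xm; case: ifP => ym //.
- by move=> xg; case: nx; exists 0%N.
- by move=> yg; case: ny; exists 0%N.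
move=> _; have := lem x; have := lem y; rewrite !le_eqVlt xm ym !orbF.
by move=> /eqP -> /eqP ->.
Qed.

(* Writing s for the successor map, every element is s^n l for a unique pair
   (n, l) with l not a successor, so that K is a union of copies of nat. *)
Lemma card_prod_nat_le : [set: K * nat] #<= [set: K].
Proof.
have /choice[s sP] : forall x : K, exists y, (x < y)%O /\
    forall z, (x < z)%O -> (y <= z)%O.
  move=> x; have [y [xy ymin]] := wf_least _ (no_max x).
  by exists y; split=> // z xz; rewrite leNgt; apply/negP => /ymin.
have slt x y : (x < y)%O -> (s x < s y)%O.
  by move=> xy; apply: (le_lt_trans ((sP x).2 _ xy)); exact: (sP y).1.
have sinj : injective s.
  by move=> x y sxy; case: (ltgtP x y) => // /slt; rewrite sxy ltxx.
have iter_inj n : injective (iter n s) by elim: n => // n IH x y /= /sinj/IH.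
have decE x : exists p : K * nat, iter p.2 s p.1 = x /\ forall y, s y <> p.1.
  have wf := (let: And3 w _ _ := cK in w).
  elim/(well_founded_ind wf): x => x IH.
  have [[y yx]|nx] := pselect (exists y, s y = x); last first.
    by exists (x, 0%N); split=> //= y yx; apply: nx; exists y.
  have [|[l n] /= [ln ll]] := IH y; first by rewrite -yx; exact: (sP y).1.
  by exists (l, n.+1); rewrite /= ln.
have dec_uniq n m l l' : (forall y, s y <> l) -> (forall y, s y <> l') ->
    iter n s l = iter m s l' -> n = m /\ l = l'.
  elim: n m => [|n IH] [|m] nl nl' //=; first by move=> /esym/nl.
    by move=> /nl'.
  by move=> /sinj /(IH _ nl nl') [-> ->].
have [c cP] := choice decE.
(* If [x] is s^n l, the pair [(x, i)] goes to s^k l, where k is a code for (n, i). *)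
pose f (p : K * nat) := iter (choice.pickle ((c p.1).2, p.2)) s (c p.1).1.
apply: (card_le_inj _ _ _ _ f) => // -[x i] [y j] _ _; rewrite /f /=.
move=> /dec_uniq[]; [exact: (cP x).2|exact: (cP y).2|].
move=> /(pcan_inj (@choice.pickleK _)) [e ->] e'.
by rewrite -(cP x).1 -(cP y).1 e e'.
Qed.

(** Pigeonhole: finite fibres would each embed in [nat], and [D] would embed in a product of
    [option K] and [nat], which has at most kappa elements. *)
Lemma infinite_fiber T (D : set T) (f : T -> option K) :
  ~ (D #<= [set: K]) -> exists c, infinite_set (D `&` f @^-1` [set c]).
Proof.
move=> nDK; apply: contrapT => nf.
have ffin c : finite_set (D `&` f @^-1` [set c]).
  by apply: contrapT => fc; apply: nf; exists c.
have /choice[g gP] : forall c, exists g : T -> nat,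
    {in D `&` f @^-1` [set c] &, injective g}.
  move=> c; have /finite_set_countable/pcard_injP[g] := ffin c.
  by exists g.
case: cK => _ Kinf _; have [k0 _] := infinite_setN0 Kinf.
(* The tag 0 or 1 tells [Some] from [None]; [k0] is a filler. *)
pose h x : (K * nat) * nat :=
  ((if f x is Some k then (k, 0%N) else (k0, 1%N)), g (f x) x).
have fh x y : h x = h y -> f x = f y /\ g (f x) x = g (f x) y.
  rewrite /h; case fx : (f x) => [k|]; case fy : (f y) => [l|] => -[] //.
    by move=> -> ->.
apply: nDK.
have /card_le_trans : D #<= [set: (K * nat) * nat].
  apply: (card_le_inj _ _ _ _ h) => // x y; rewrite !inE => Dx Dy /fh[fxy].
  by apply: gP; rewrite inE; split.
have KK : [set: (K * nat) * nat] #<= [set: K * nat].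
  pose e (p : (K * nat) * nat) := (p.1.1, choice.pickle (p.1.2, p.2)).
  apply: (card_le_inj _ _ _ _ e) => // -[[x i] j] [[y k] l] _ _ [-> /=].
  by move=> /(pcan_inj (@choice.pickleK _)) [-> ->].
by apply; apply: card_le_trans KK card_prod_nat_le.
Qed.

End Cardinal.

(** * Separation of many branches at a common level *)

Definition agree_below {d} {K : orderType d} (eta : K) (a b : K -> bool) : Prop :=
  forall x, (x < eta)%O -> a x = b x.

Lemma seq_max_ex d (K : orderType d) (k0 : K) (s : seq K) :
  exists2 k, k \in k0 :: s & forall i, i \in k0 :: s -> (i <= k)%O.
Proof.
elim: s k0 => [|k1 s IH] k0.
  by exists k0 => [|i]; rewrite ?mem_seq1// => /eqP ->.
have [k ks kmax] := IH k1; have [k0k|/ltW kk0] := leP k0 k.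
  by exists k => [|i]; rewrite inE ?ks ?orbT// => /predU1P[->|/kmax].
exists k0 => [|i]; rewrite ?mem_head// inE => /predU1P[->//|/kmax ik].
exact: le_trans ik kk0.
Qed.

(* Call eta an isolating level of x if no other element of D agrees with x
   below eta.  Infinitely many elements of D have the same least isolating
   level (or none at all); finitely many of them are told apart by their digits
   up to some eta below that level, and those having the same digit at eta are
   told apart strictly below eta. *)
Lemma many_splittings d (K : orderType d) T (D : set T) (br : T -> K -> bool) :
  infinite_cardinal K -> {in D &, injective br} -> ~ (D #<= [set: K]) ->
  forall n, exists (eta : K) (x y : 'I_n -> T),
    (forall i, [/\ D (x i), D (y i), x i <> y i &
                   agree_below eta (br (x i)) (br (y i))]) /\
    (forall i j, i != j -> ~ agree_below eta (br (x i)) (br (x j))).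
Proof.
move=> cK brinj nDK n.
pose iso x eta := forall y, D y -> agree_below eta (br x) (br y) -> y = x.
have /choice[l lP] : forall x, exists o : option K,
    if o is Some eta then iso x eta /\ forall z, (z < eta)%O -> ~ iso x z
    else forall z, ~ iso x z.
  move=> x; have [e|ne] := pselect (exists eta, iso x eta).
    by have [eta etaP] := wf_least _ _ cK _ e; exists (Some eta).
  by exists None => z iz; apply: ne; exists z.
have [c /infinite_set_inj[z [zinj zD]]] := infinite_fiber _ _ cK _ _ l nDK.
(* [P] holds strictly below the common least isolating level, and everywhere if there is none. *)
pose P eta := if c is Some delta then (eta < delta)%O else true.
have noiso i eta : P eta -> exists y,
    [/\ D y, z i <> y & agree_below eta (br (z i)) (br y)].
  move=> Peta; apply: contrapT => ny.
  have : iso (z i) eta.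
    by move=> y Dy ay; apply: contrapT => yz; apply: ny; exists y; split=> // /esym.
  have := lP (z i); rewrite (zD i).2; move: Peta; rewrite /P.
  by case: c {zD P} => [delta ed [_ /(_ _ ed)]|_ /(_ eta)].
(* Agreement on all of [P] is agreement below an isolating level, or everywhere if there is none;
   either way the two elements coincide. *)
have sep i j : i != j -> exists x, P x /\ br (z i) x <> br (z j) x.
  move=> ij; apply: contrapT => nx.
  have ag x : P x -> br (z i) x = br (z j) x.
    by move=> Px; apply: contrapT => e; apply: nx; exists x.
  suff /zinj ji : z j = z i by rewrite ji eqxx in ij.
  have := lP (z i); rewrite (zD i).2; move: ag; rewrite /P.
  case E : c => [delta|] ag.
    by case=> iz _; apply: iz; [exact: (zD j).1|exact: ag].
  move=> _; apply: brinj; rewrite ?inE; [exact: (zD j).1|exact: (zD i).1|].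
  by apply/funext => x; rewrite ag.
have [k0 [Pk0 _]] := sep 0%N 1%N isT.
have /choice[Dl DlP] : forall p : 'I_(n + n) * 'I_(n + n), exists x,
    P x /\ (p.1 != p.2 -> br (z p.1) x <> br (z p.2) x).
  move=> [i j] /=; have [->|/sep[x [Px xP]]] := eqVneq i j; last by exists x.
  by exists k0; split; rewrite ?eqxx.
(* Starting the list with [k0] keeps it non-empty even for [n = 0], with its maximum still in
   [P]. *)
have [eta etaD etamax] := seq_max_ex _ _ k0 (codom Dl).
have Peta : P eta.
  by move: etaD; rewrite inE => /predU1P[->//|/codomP[p ->]]; exact: (DlP p).1.
have etaP p : (Dl p <= eta)%O by apply: etamax; rewrite inE codom_f orbT.
have septo (i j : 'I_(n + n)) : i != j -> br (z i) eta = br (z j) eta ->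
    ~ agree_below eta (br (z i)) (br (z j)).
  move=> ij e ag; have [_ /(_ ij)] := DlP (i, j); apply => /=.
  by have := etaP (i, j); rewrite le_eqVlt => /predU1P[->|/ag].
(* At least half of the 2n elements share their digit at [eta]; this is why 2n of them were
   taken. *)
have [b nb] : exists b, (n <= #|[pred i : 'I_(n + n) | br (z i) eta == b]|)%N.
  apply: contrapT => nb.
  have lt b : (#|[pred i : 'I_(n + n) | br (z i) eta == b]| < n)%N.
    by rewrite ltnNge; apply/negP => nb'; apply: nb; exists b.
  have := cardC [pred i : 'I_(n + n) | br (z i) eta == true].
  rewrite card_ord (@eq_card _ (predC _) [pred i : 'I_(n + n) | br (z i) eta == false]).
    by move=> e; have := leq_add (lt true) (ltnW (lt false)); rewrite addSn e ltnn.
  by move=> i; rewrite !inE; case: (br _ _).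
pose x i := enum_val (widen_ord nb i).
have [y yP] := choice (fun i => noiso (x i) eta Peta).
exists eta, (fun i => z (x i)), y; split.
  by move=> i; have [? ? ?] := yP i; split=> //; exact: (zD _).1.
move=> i j ij; apply: septo; last first.
  have xb k : br (z (x k)) eta = b by have /eqP := enum_valP (widen_ord nb k).
  by rewrite !xb.
apply: contra ij => /eqP /enum_val_inj /(congr1 val) /= e.
exact/eqP/val_inj.
Qed.

(** * Segments cut out of branches *)

Section TreeSums.
Context (R : realType) (d : Order.disp_t) (K : orderType d).
Implicit Types (x : c00 R (node K)) (I : set (node K)) (B : K -> bool).

Definition branch_node B (eta : K) : node K :=
  @Node d K eta (fun x : {x : K | (x < eta)%O} => B (proj1_sig x)).

(** Both ends are included: the node at level [eta2] is then the least upper bound of the slice,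
    whether [eta2] is a limit or a successor. *)
Definition branch_slice B (eta1 eta2 : K) : set (node K) :=
  [set branch_node B xi | xi in [set xi | (eta1 <= xi <= eta2)%O]].

Lemma branch_node_le B xi eta :
  (xi <= eta)%O -> node_le (branch_node B xi) (branch_node B eta).
Proof. by move=> xe; split. Qed.

Lemma le_branch_node B eta t :
  node_le t (branch_node B eta) -> t = branch_node B (lev t).
Proof.
case: t => l dg [/= le tB]; rewrite /branch_node; congr Node.
apply/funext => -[y yl] /=.
by have := tB y yl (lt_le_trans yl le).
Qed.

Lemma branch_node_eq B B' xi xi' :
  branch_node B xi = branch_node B' xi' -> xi = xi' /\ agree_below xi B B'.
Proof.
move=> e; have xx : xi = xi' := congr1 (@lev d K) e.
split=> // y yx.
have [_] : node_le (branch_node B xi) (branch_node B' xi') by rewrite -e.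
by move=> /(_ y yx); rewrite -xx => /(_ yx).
Qed.

Lemma agree_branch_node B B' xi :
  agree_below xi B B' -> branch_node B xi = branch_node B' xi.
Proof.
by move=> BB'; congr Node; apply/funext => -[y yx] /=; exact: BB'.
Qed.

Lemma eta_segment_branch_slice B eta1 eta2 : (eta1 < eta2)%O ->
  eta_segment eta1 eta2 (branch_slice B eta1 eta2).
Proof.
move=> e12; have e12' := ltW e12.
have S1 : branch_slice B eta1 eta2 (branch_node B eta1).
  by exists eta1 => //=; rewrite lexx.
have S2 : branch_slice B eta1 eta2 (branch_node B eta2).
  by exists eta2 => //=; rewrite lexx e12'.
split.
- split.
    move=> _ _ [xi _ <-] [zeta _ <-].
    by case: (leP xi zeta) => [|/ltW] le; [left|right]; exact: branch_node_le.
  move=> _ t _ [xi /= /andP[exi _] <-] [zeta /= /andP[_ zee] <-] [st _] [ts' _].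
  (* A node below a node of [B] is itself a node of [B], so only its level has to be located. *)
  rewrite (le_branch_node _ _ _ ts'); eexists; last reflexivity.
  by rewrite /= (le_trans exi st.1) (le_trans ts'.1 zee).
- by exists (branch_node B eta1).
- split; first by exists (branch_node B eta1).
  by move=> _ [_ [xi /= /andP[exi _] <-] <-].
- split.
    exists (branch_node B eta2) => // _ [xi /= /andP[_ xie] <-].
    exact: branch_node_le.
  by move=> _ [t /= tub <-]; have [] := tub _ S2.
Qed.

(** A node common to two slices has level at least [eta1], so the two branches would agree below
    [eta1]. *)
Lemma admissible_branch_slices n (B : 'I_n -> K -> bool) eta1 eta2 :
  (eta1 < eta2)%O -> (forall i j, i != j -> ~ agree_below eta1 (B i) (B j)) ->
  admissible (fun i => branch_slice (B i) eta1 eta2).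
Proof.
move=> e12 BB; split; last first.
  by exists eta1, eta2; split=> // j; exact: eta_segment_branch_slice.
apply/trivIsetP => i j _ _ ij; apply/seteqP; split=> // s [].
move=> [xi /= /andP[exi _] <-] [zeta _ /esym/branch_node_eq[_ ag]].
by apply: (BB _ _ ij) => y ye; apply: ag; exact: lt_le_trans exi.
Qed.

(** * Norm estimates for admissible families *)

Definition supp x := fset_set [set s | x s != 0].

Lemma in_supp x (s : node K) : (s \in supp x) = (x s != 0).
Proof.
have fx : finite_set [set s | x s != 0] by have := c00_valP x; rewrite inE.
by rewrite /supp in_fset_set//; apply/idP/idP; rewrite inE.
Qed.

(** Puts the sums over all sets on one finite index list, where they can be exchanged and subtracted
    termwise. *)
Lemma node_sumE I x :
  node_sum I x = \sum_(s <- supp x) (if s \in I then x s else 0).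
Proof.
rewrite /node_sum fsbig_mkcond (fsbigTE (supp x))// => s.
by rewrite in_supp negbK /patch => /eqP ->; case: ifP.
Qed.

Lemma sum_sqr_le n (y : 'I_n -> R) :
  \sum_(j < n) `|y j| ^+ 2 <= (\sum_(j < n) `|y j|) ^+ 2.
Proof.
rewrite [leRHS]expr2 mulr_suml ler_sum// => j _; rewrite expr2 ler_wpM2l//.
by rewrite (bigD1 j)//= lerDl sumr_ge0.
Qed.

(** Cauchy-Schwarz against a constant vector, read off from the non-negative sum of the squares of n
    |y_j| - S. *)
Lemma sqr_sum_le n (y : 'I_n -> R) :
  (\sum_(j < n) `|y j|) ^+ 2 <= n%:R * \sum_(j < n) `|y j| ^+ 2.
Proof.
case: n y => [|n] y; first by rewrite !big_ord0 mulr0 expr0n.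
set S := \sum_j _; set Q := \sum_j _.
have : 0 <= \sum_(j < n.+1) (n.+1%:R * `|y j| - S) ^+ 2.
  by apply: sumr_ge0 => j _; exact: sqr_ge0.
have -> : \sum_(j < n.+1) (n.+1%:R * `|y j| - S) ^+ 2 =
    n.+1%:R * (n.+1%:R * Q - S ^+ 2).
  rewrite (eq_bigr (fun j => n.+1%:R ^+ 2 * `|y j| ^+ 2 +
    (- (2 * n.+1%:R * S)) * `|y j| + S ^+ 2)); last by move=> j _; ring.
  rewrite !big_split/= -!mulr_sumr -/S -/Q sumr_const card_ord -mulr_natr.
  ring.
by rewrite pmulr_rge0 ?ltr0n// subr_ge0.
Qed.

(** Disjoint segments count each node of the support at most once. The bound is the same for all
    families, so the supremum in [tree_norm] is finite. *)
Lemma admissible_bound r (I : 'I_r -> set (node K)) x : admissible I ->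
  Num.sqrt (\sum_(j < r) `|node_sum (I j) x| ^+ 2) <= \sum_(s <- supp x) `|x s|.
Proof.
move=> [/trivIsetP Idisj _].
rewrite -[leRHS]ger0_norm ?sumr_ge0// -sqrtr_sqr ler_wsqrtr//.
apply: le_trans (sum_sqr_le _ _) _.
rewrite ler_sqr ?nnegrE ?sumr_ge0//.
apply: (@le_trans _ _ (\sum_(j < r) \sum_(s <- supp x)
    (if s \in I j then `|x s| else 0))).
  apply: ler_sum => j _; rewrite node_sumE (le_trans (ler_norm_sum _ _ _))//.
  by apply: ler_sum => s _; case: ifP; rewrite ?normr0.
rewrite exchange_big/=; apply: ler_sum => s _.
have [[j sj]|nj] := pselect (exists j, s \in I j); last first.
  by rewrite big1// => j _; case: ifP => // sj; case: nj; exists j.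
rewrite (bigD1 j)//= sj big1 ?addr0// => i ij; case: ifP => // si.
have := Idisj i j Logic.I Logic.I ij; move=> /seteqP[/(_ s) + _].
by move: si sj; rewrite !inE => si sj /(_ (conj si sj)).
Qed.

Lemma admissible_tree_norm r (I : 'I_r -> set (node K)) x : admissible I ->
  Num.sqrt (\sum_(j < r) `|node_sum (I j) x| ^+ 2) <= tree_norm x.
Proof.
move=> adI; apply: ub_le_sup; last by exists r, I.
by exists (\sum_(s <- supp x) `|x s|) => _ [? [? [? ->]]]; exact: admissible_bound.
Qed.

Lemma sum_admissible_le n (I : 'I_n -> set (node K)) x : admissible I ->
  `|\sum_(j < n) node_sum (I j) x| <= Num.sqrt n%:R * tree_norm x.
Proof.
move=> adI; apply: le_trans (ler_norm_sum _ _ _) _.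
apply: le_trans (ler_wpM2l (sqrtr_ge0 _) (admissible_tree_norm _ _ x adI)).
rewrite -sqrtrM// -[leLHS]ger0_norm ?sumr_ge0// -sqrtr_sqr ler_wsqrtr//.
exact: sqr_sum_le.
Qed.

(* Below eta1 the branches B and B' have the same nodes, which cancel, and
   above eta2 there are no nodes in the support of x. *)
Lemma node_sum_branchB B B' eta1 eta2 x : agree_below eta1 B B' ->
  (forall s : node K, s \in supp x -> (lev s <= eta2)%O) ->
  node_sum (branch_nodes B) x - node_sum (branch_nodes B') x =
  node_sum (branch_slice B eta1 eta2) x - node_sum (branch_slice B' eta1 eta2) x.
Proof.
move=> ag sup; rewrite !node_sumE -!sumrB.
rewrite big_seq [RHS]big_seq; apply: eq_bigr => s /sup le2.
have slice C : (s \in branch_slice C eta1 eta2) =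
    (eta1 <= lev s)%O && (s \in branch_nodes C).
  apply/idP/andP; rewrite !inE.
    by move=> [xi /= /andP[e1 _] <-]; split=> //; exists xi.
  by move=> [e1 [xi _ e]]; exists xi => //=; move: e1 le2; rewrite -e /= => -> ->.
rewrite !slice; case: leP => //= lt1.
suff -> : (s \in branch_nodes B) = (s \in branch_nodes B') by rewrite !subrr.
have br C : s \in branch_nodes C -> s = branch_node C (lev s).
  by rewrite inE => -[xi _ <-].
have ag' : branch_node B (lev s) = branch_node B' (lev s).
  by apply: agree_branch_node => y ys; apply: ag; exact: lt_trans lt1.
by apply/idP/idP => /br e; rewrite inE; exists (lev s) => //; rewrite [RHS]e.
Qed.

End TreeSums.

(** * Functionals on the completion and the contradiction *)

Lemma dual_norm_dense_le (R : realType) (X : normedModType R) (A : set X)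
    (f : dual X) (c : R) : 0 <= c -> dense A ->
  (forall x, A x -> `|f x| <= c * `|x|) -> `|f| <= c.
Proof.
move=> c0 dA fA.
have fX x : `|f x| <= c * `|x|.
  rewrite leNgt; apply/negP => fx.
  (* The set where [g] is positive is open and contains [x], hence meets the dense set [A]. *)
  pose g (y : X) : R := `|f y| - c * `|y|.
  have gc : continuous g.
    move=> y; apply: (@cvgB _ R^o); first by apply: cvg_norm; exact: dual_continuous.
    by apply: (@cvgZl_tmp _ R^o); apply: cvg_norm.
  have [||y [/= + /fA]] := dA (g @^-1` [set t | 0 < t]);
    first by exists x; rewrite /g/= subr_gt0.
    by apply: open_comp => [y _|]; [exact: gc|exact: open_gt].
  by rewrite /g subr_gt0 leNgt => ->.
apply: ge_sup; first exact: (dual_has_sup f).1.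
move=> _ [x /= x1 <-]; apply: le_trans (fX x) _.
by rewrite -[leRHS]mulr1 ler_wpM2l.
Qed.

Theorem theorem3p2 (R : realType) (d : Order.disp_t) (K : orderType d)
    (Ksucc : Type) (X : completeNormedModType R)
    (iota : {linear c00 R (node K) -> X}) :
  infinite_cardinal K ->
  successor_cardinal K Ksucc ->
  is_completion (@tree_norm R d K) iota ->
  ~ exists D : set (dual X),
      D `<=` Gamma_star iota /\ equivalent_l1_basis Ksucc D.
Proof.
move=> cK [[_ nKK] _] [iotaN iotaD] [D [DG [/card_eqPle[_ KD] [C1 [C2 [C10 _ DC]]]]]].
have nDK : ~ (D #<= [set: K]) by move=> /(card_le_trans KD).
have /choice[br brP] : forall phi : dual X, exists B : K -> bool,
    D phi -> is_branch_functional iota B phi.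
  move=> phi; have [/DG[B BP]|nD] := pselect (D phi); first by exists B.
  by exists (fun=> false).
have brinj : {in D &, injective br}.
  move=> phi psi; rewrite !inE => Dphi Dpsi e; apply/eqP; rewrite -subr_eq0 -normr_le0.
  (* With the constant 0: functionals equal on the dense range of [iota] are equal. *)
  apply: dual_norm_dense_le iotaD _ => // _ [v _ <-].
  change (`|phi (iota v) - psi (iota v)| <= 0 * `|iota v|).
  by rewrite (brP _ Dphi) (brP _ Dpsi) e subrr normr0 mul0r.
(* The two norm estimates will give C1 n <= sqrt n, that is C1^2 n <= 1, which this [n] violates. *)
have [n nC] : exists n : nat, 1 < C1 ^+ 2 * n%:R.
  exists (Num.bound (C1 ^- 2)); rewrite -ltr_pdivrMl ?exprn_gt0// mulr1.
  by apply: archi_boundP; rewrite invr_ge0 exprn_ge0// ltW.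
have [eta [x [y [xyP sepx]]]] := many_splittings _ _ _ _ br cK brinj nDK n.
have sepy i j : i != j -> ~ agree_below eta (br (y i)) (br (y j)).
  move=> ij ag; apply: (sepx _ _ ij) => z ze.
  by have [_ _ _ ->//] := xyP i; have [_ _ _ ->//] := xyP j; apply: ag.
have upper : `|\sum_(i < n) (x i - y i)| <= 2 * Num.sqrt n%:R.
  apply: dual_norm_dense_le iotaD _; first by rewrite mulr_ge0 ?sqrtr_ge0.
  move=> _ [v _ <-]; rewrite iotaN.
  have [eta0 eta_lt] := no_max _ _ cK eta.
  (* [eta2] may depend on [v]: it bounds the levels of the support, so the slices miss no relevant
     node from level [eta] on. Including [eta0] forces [eta < eta2] even for an empty support. *)
  have [eta2 [eta_lt2 supE]] : exists eta2 : K, (eta < eta2)%O /\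
      forall s : node K, s \in supp _ _ _ v -> (lev s <= eta2)%O.
    have [eta2 _ le2] := seq_max_ex _ _ eta0 [seq lev s | s <- supp _ _ _ v].
    exists eta2; split=> [|s sv].
      by apply: lt_le_trans eta_lt (le2 _ _); rewrite mem_head.
    by apply: le2; rewrite inE map_f ?orbT.
  have evalE : (\sum_(i < n) (x i - y i)) (iota v) =
      \sum_(i < n) node_sum (branch_slice _ _ (br (x i)) eta eta2) v -
      \sum_(i < n) node_sum (branch_slice _ _ (br (y i)) eta eta2) v.
    rewrite -sumrB (big_morph (fun f : dual X => f (iota v)) (id1 := 0) (op1 := +%R))//.
    apply: eq_bigr => i _; have [Dx Dy _ ag] := xyP i.
    change (x i (iota v) - y i (iota v) =
      node_sum (branch_slice _ _ (br (x i)) eta eta2) v -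
      node_sum (branch_slice _ _ (br (y i)) eta eta2) v).
    by rewrite (brP _ Dx) (brP _ Dy); exact: node_sum_branchB.
  rewrite evalE (le_trans (ler_normB _ _))// -mulrA mulr_natl mulr2n.
  by rewrite lerD// sum_admissible_le//; exact: admissible_branch_slices.
have lower : C1 * (n + n)%:R <= `|\sum_(i < n) (x i - y i)|.
  (* The lower estimate is applied to 2n vectors, with coefficient 1 on each [x i] and -1 on each
     [y i]. *)
  pose z (k : 'I_(n + n)) := match fintype.split k with inl i => x i | inr i => y i end.
  pose a (k : 'I_(n + n)) : R :=
    match fintype.split k with inl i => 1 | inr i => -1 end.
  have xinj i j : x i = x j -> i = j.
    move=> e; apply/eqP; apply: contrapT => /negP/sepx; apply.
    by rewrite e => t _.
  have yinj i j : y i = y j -> i = j.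
    move=> e; apply/eqP; apply: contrapT => /negP/sepy; apply.
    by rewrite e => t _.
  (* For distinct indices, [y j] agrees with [x j] below [eta], whereas [x i] does not. *)
  have xy i j : x i <> y j.
    have [_ _ + ag] := xyP j; have [-> //|ij _ e] := eqVneq i j.
    by apply: (sepx _ _ ij); rewrite e => t /ag ->.
  have zinj : injective z.
    move=> k k' zk; apply: (can_inj (@fintype.splitK _ _)); move: zk; rewrite /z.
    case: (fintype.split k) => i; case: (fintype.split k') => j.
    - by move=> /xinj ->.
    - by move=> /xy.
    - by move=> /esym/xy.
    - by move=> /yinj ->.
  have zD k : D (z k) by rewrite /z; case: fintype.split => i; have [] := xyP i.
  have [+ _] := DC _ z a zinj zD.
  have zl i : z (lshift n i) = x i by rewrite /z (unsplitK (inl i)).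
  have zr i : z (rshift n i) = y i by rewrite /z (unsplitK (inr i)).
  have al i : a (lshift n i) = 1 by rewrite /a (unsplitK (inl i)).
  have ar i : a (rshift n i) = -1 by rewrite /a (unsplitK (inr i)).
  have -> : \sum_(k < n + n) `|a k| = (n + n)%:R.
    rewrite (eq_bigr (fun=> 1)) ?sumr_const ?card_ord// => k _.
    by rewrite /a; case: fintype.split => i; rewrite ?normrN normr1.
  rewrite big_split_ord/=.
  under eq_bigr do rewrite zl al scale1r.
  by under [X in _ + X]eq_bigr do rewrite zr ar scaleN1r; rewrite sumrN -sumrB.
have : C1 * n%:R <= Num.sqrt n%:R.
  by move: (le_trans lower upper); rewrite natrD; lra.
have C1n0 : 0 <= C1 * n%:R by rewrite mulr_ge0// ltW.
(* Square and divide by [n], which is positive because [n = 0] contradicts [nC]. *)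
rewrite -ler_sqr ?nnegrE ?sqrtr_ge0// sqr_sqrtr// => le.
have n0 : 0 < n%:R :> R.
  by rewrite ltr0n lt0n; apply: contraTneq nC => ->; rewrite mulr0 ltr10.
have : C1 ^+ 2 * n%:R <= 1 by rewrite -(ler_pM2r n0) mul1r -mulrA -expr2 -exprMn.
by rewrite leNgt nC.
Qed.
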